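(* Let $t\ge1$, $\alpha>0$, $\mathbf{h}=[h_1\cdots h_t]^T\sim\mathrm{CN}(\mathbf{I}_t)$, and $\mathbf{h}_i=[h_1\cdots h_i]^T$. For an integer $\ell\ge0$ and $x\in[-1,1]$ let $q(x;\ell)=\mathrm{sign}(x)\,2^{-(\ell+1)}\lfloor |x|2^{\ell+1}\rfloor$, and for $\mathbf{x}\in\mathbb{C}^i$ with $\|\mathbf{x}\|\le1$ let $q(\mathbf{x};\ell)$ be the vector whose $k$-th entry is $q(\Re x_k;\ell)+\mathrm{j}\,q(\Im x_k;\ell)$. For $\|\mathbf{h}_i\|^2>\alpha$ let $L(\mathbf{h}_i)=\max\{\lceil\log_2(4i)\rceil,\lceil\log_2\frac{4i\alpha}{\|\mathbf{h}_i\|^2-\alpha}\rceil\}$ and $\mathtt{C}_i(\mathbf{h}_i)=q(\mathbf{h}_i/\|\mathbf{h}_i\|;L(\mathbf{h}_i))\in\mathbb{C}^i$. Scheme $\mathtt{D}$ operates as follows: starting with $i=1$, the transmitter trains antenna $i$ (the receiver learns $h_i$, hence $\mathbf{h}_i$). If $\|\mathbf{h}_i\|^2\le\alpha$, the receiver feeds back the single bit $\mathtt{0}$; then if $i<t$ set $i\leftarrow i+1$ and repeat, while if $i=t$ the transmitter transmits with $\mathbf{e}_1$. If $\|\mathbf{h}_i\|^2>\alpha$, the receiver feeds back a codeword of $2i(L(\mathbf{h}_i)+3)$ bits describing $\mathtt{C}_i(\mathbf{h}_i)$, and the transmitter transmits with the beamforming vector $[\mathtt{C}_i(\mathbf{h}_i)^T\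 \mathbf{0}_{1\times(t-i)}]^T$. Then $\mathtt{out}(\mathtt{D})=\mathtt{out}(\mathtt{F})=\mathrm{P}(\|\mathbf{h}\|^2<\alpha)$, $\mathtt{tl}(\mathtt{D})\le 1+\alpha$, and $\mathtt{fr}(\mathtt{D})\le 92(1+\alpha^3)$.
   Context: $\mathbf{e}_1$ is the first standard basis vector of $\mathbb{C}^t$; $\mathrm{j}=\sqrt{-1}$. For a scheme transmitting with beamforming vector $\mathbf{x}(\mathbf{h})$ ($\|\mathbf{x}\|\le1$), the outage probability is $\mathtt{out}=\mathrm{P}(|\langle\mathbf{x}(\mathbf{h}),\mathbf{h}\rangle|^2<\alpha)$ with $\langle\mathbf{x},\mathbf{h}\rangle=\sum_k\overline{x_k}h_k$; $\mathtt{out}(\mathtt{F})=\mathrm{P}(\|\mathbf{h}\|^2<\alpha)$ is the outage probability with perfect channel knowledge (beamforming along $\mathbf{h}/\|\mathbf{h}\|$). The training length $\mathtt{tl}$ is the expected number of antennas trained per channel state, and the feedback rate $\mathtt{fr}$ is the expected total number of feedback bits per channel state (counting each one-bit $\mathtt{0}$ message and the final codeword). $\mathrm{CN}(\mathbf{I}_t)$: i.i.d. standard circularly-symmetric complex Gaussian entries. *)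

(* Defs.v *)
From mathcomp Require Import all_boot all_order all_algebra.
From mathcomp Require Import all_classical all_reals all_analysis.
From mathcomp Require Export complex.

Set Implicit Arguments.
Unset Strict Implicit.
Unset Printing Implicit Defensive.

Import Order.TTheory GRing.Theory Num.Theory ComplexField ComplexField.Normc.
Local Open Scope ring_scope.
Local Open Scope complex_scope.
Local Open Scope classical_set_scope.

Section Scheme.
Context {R : realType} (t : nat) (alpha : R).
Implicit Types (h x : 'I_t -> R[i]).

Definition log2 (y : R) : R := ln y / ln 2.

(* ||h_i||^2 = sum_{k <= i} |h_k|^2  (antennas are 1-indexed in the paper,
   0-indexed here: h_i = [h 0; ...; h (i-1)]) *)
Definition nrm2 h (i : nat) : R := \sum_(k < t | (k < i)%N) normc (h k) ^+ 2.

Definition qr (y : R) (l : int) : R :=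
  Num.sg y * (2 : R) ^ (- (l + 1)) * (Num.floor (`|y| * (2 : R) ^ (l + 1)))%:~R.

Definition qc (z : R[i]) (l : int) : R[i] := qr (complex.Re z) l +i* qr (complex.Im z) l.

Definition Lq h (i : nat) : int :=
  Num.max (Num.ceil (log2 (4 * i%:R)))
          (Num.ceil (log2 (4 * i%:R * alpha / (nrm2 h i - alpha)))).

(* 0-based position, in [1; ...; t], of the first i with ||h_i||^2 > alpha
   (equal to t if there is none) *)
Definition firstD h : nat := find (fun i => alpha < nrm2 h i) (iota 1 t).

Definition exceedD h : bool := (firstD h < t)%N.

Definition stopD h : nat := if exceedD h then (firstD h).+1 else t.

Definition trainedD h : nat := stopD h.

(* number of feedback bits sent by scheme D: (i-1) bits '0' followed by a
   codeword of 2i(L(h_i)+3) bits, or t bits '0' if no i has ||h_i||^2 > alpha *)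
Definition feedbackD h : R :=
  if exceedD h then
    (stopD h).-1%:R + (2 * stopD h)%:R * (Lq h (stopD h) + 3)%:~R
  else t%:R.

Definition beamD h : 'I_t -> R[i] := fun k =>
  if exceedD h then
    (if (k < stopD h)%N
     then qc (h k / (Num.sqrt (nrm2 h (stopD h)))%:C) (Lq h (stopD h))
     else 0)
  else (val k == 0%N)%:R.

Definition beamF h : 'I_t -> R[i] := fun k => h k / (Num.sqrt (nrm2 h t))%:C.

Definition gain x h : R := normc (\sum_(k < t) (x k)^* * h k) ^+ 2.

End Scheme.

(* h ~ CN(I_t) on a probability space: the real and imaginary parts of the
   entries are 2t random variables that are independent and N(0, 1/2)
   (standard deviation sqrt(1/2)); i.e. their joint law is the product law. *)
Definition is_CN_std {d : measure_display} {T : measurableType d} {R : realType}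
  (P : probability T R) (t : nat) (hv : 'I_t -> T -> R[i]) : Prop :=
  (forall k, measurable_fun setT (fun w => complex.Re (hv k w)) /\
             measurable_fun setT (fun w => complex.Im (hv k w))) /\
  forall A B : 'I_t -> set R,
    (forall k, measurable (A k) /\ measurable (B k)) ->
    P (\bigcap_(k in [set: 'I_t])
         ((fun w => complex.Re (hv k w)) @^-1` A k `&` (fun w => complex.Im (hv k w)) @^-1` B k))
    = (\prod_(k < t) (fine (normal_prob 0 (Num.sqrt (2^-1)) (A k))
                      * fine (normal_prob 0 (Num.sqrt (2^-1)) (B k))))%:E.

Definition outage {d : measure_display} {T : measurableType d} {R : realType}
  (P : probability T R) (t : nat) (alpha : R) (hv : 'I_t -> T -> R[i])
  (xs : ('I_t -> R[i]) -> 'I_t -> R[i]) : \bar R :=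
  P [set w | gain (xs (fun k => hv k w)) (fun k => hv k w) < alpha].

(* Main.v *)
Require Import Defs.
From mathcomp Require Import all_boot all_order all_algebra.
From mathcomp Require Import all_classical all_reals all_analysis.
From mathcomp Require Import complex.
From mathcomp Require Import measurable_realfun ring lra zify.
Import Order.TTheory GRing.Theory Num.Theory ComplexField ComplexField.Normc.
Import numFieldNormedType.Exports.
Local Open Scope classical_set_scope.
Local Open Scope ring_scope.

(* Write S_i = ||h_i||^2, a sum of independent Exp(1) variables, so that the S_i
   are the arrival times of a unit-rate Poisson process.

   Outage: rounding towards 0 loses at most the quantization step in each real
   coordinate, and L is chosen so that the loss keeps the gain above alpha once
   S_i > alpha; otherwise S_t <= alpha and the gain of e_1 is |h_1|^2 <= S_t, so
   the outage events of D and F differ only inside the null set {S_t = alpha}.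

   Training: tl = 1 + sum_{0<i<t} P(S_i <= alpha), and the renewal sum is at most
   alpha.  More generally sum_i (u + v i) P(S_i <= a) <= u a + v (a^2/2 + a), by
   induction on the number of terms, convolving with one exponential variable:
   if g(0) = 0 then E[(g + g')(a - X); X <= a] = g(a) for X ~ Exp(1).

   Feedback: L <= (i + 1) + N, with N at most the number of m >= 0 for
   which S_i <= alpha + alpha / 2^m.  As the exponential density is at most 1, each
   such event, given S_{i-1} <= alpha, has probability at most alpha / 2^m, so
   its expected contribution is controlled by the same renewal sums; in total
   fr <= 10 + 19 alpha + 10 alpha^2 + 2 alpha^3. *)

(** * The squared modulus of a complex Gaussian is exponential *)

Section real_integrals.
Context {R : realType}.
Local Notation mu := (@lebesgue_measure R).

Lemma preimage_scale_itvoc (c a b : R) : 0 < c ->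
  (fun x : R => c * x) @^-1` `]a, b]%classic = `]a / c, b / c]%classic.
Proof.
move=> c0; apply/eq_set => x /=.
by rewrite !in_itv/= ltr_pdivrMr// ler_pdivlMr// [x * c]mulrC.
Qed.

(** Lebesgue measure and [c] times its image under x -> c x agree on half-open intervals, hence on
    all measurable sets. *)
Lemma ge0_integral_scale (c : R) (f : R -> \bar R) : 0 < c ->
  measurable_fun [set: R] f -> (forall x, 0 <= f x)%E ->
  (\int[mu]_x f x = c%:E * \int[mu]_x f (c * x)%R)%E.
Proof.
move=> c0 mf f0.
pose phi : R -> measurableTypeR R := fun x => (c * x)%R.
have mphi : measurable_fun setT phi.
  by apply: measurable_funM => //; exact: measurable_cst.
have c0' : 0 <= c by exact: ltW.
pose k : {nonneg R} := NngNum c0'.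
have E (A : set R) : measurable A -> mu A = mscale k (pushforward mu phi) A.
  move=> mA; apply: lebesgue_measure_unique => // _ [[a b]] _ <-.
  transitivity (c%:E * mu ((fun x => c * x)%R @^-1` `]a, b]%classic))%E; last by [].
  rewrite preimage_scale_itvoc// !lebesgue_measure_itv/=.
  rewrite !lte_fin ltr_pM2r ?invr_gt0//; case: ifP => _; last by rewrite mule0.
  by rewrite -EFinM -mulrBl mulrCA divff ?mulr1 ?gt_eqF.
rewrite (eq_measure_integral (mscale k (pushforward mu phi))) => [|A mA _]; last exact: E.
rewrite ge0_integral_mscale//= ge0_integral_pushforward//.
Qed.

End real_integrals.

Section polar.
Context {R : realType}.
Local Notation mu := (@lebesgue_measure R).

Lemma integralT_oneDsqrV :
  (\int[mu]_x ((1 + x ^+ 2)^-1)%:E = (pi : R)%:E)%E.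
Proof.
rewrite (@ge0_symfun_integralT _ (fun x => (oneDsqr x)^-1)).
- rewrite -set_itvcy integral0y_oneDsqr -EFinM; congr EFin.
  by rewrite mulrCA divff ?mulr1.
- by move=> x; rewrite invr_ge0 (le_trans ler01)// oneDsqr_ge1.
- exact: continuous_oneDsqrV.
- by move=> x; rewrite /= /oneDsqr sqrrN.
Qed.

(* Polar coordinates in the form v = |u| w: by Tonelli the integral over u for
   fixed w is a linear rescaling, which leaves the factor 1 / (1 + w^2). *)
Lemma ge0_integral_polar (G : R -> \bar R) :
  measurable_fun [set: R] G -> (forall x, 0 <= G x)%E ->
  (\int[mu]_u \int[mu]_v G (u ^+ 2 + v ^+ 2)%R =
   (pi : R)%:E * \int[mu]_s (`|s|%:E * G (s ^+ 2)%R))%E.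
Proof.
move=> mG G0.
pose H (z : R * R) : \bar R := (`|z.1|%:E * G (z.1 ^+ 2 * (1 + z.2 ^+ 2))%R)%E.
have mH : measurable_fun setT H.
  apply: emeasurable_funM.
    by apply/measurable_EFinP; apply: measurableT_comp.
  apply: (measurableT_comp mG); apply: measurable_funM.
    exact: measurable_funX.
  by apply: measurable_funD => //; exact: measurable_funX.
have H0 z : (0 <= H z)%E by apply: mule_ge0; rewrite ?lee_fin.
have mL : measurable_fun setT (fun z : R * R => G (z.1 ^+ 2 + z.2 ^+ 2)%R).
  by apply: (measurableT_comp mG); apply: measurable_funD; exact: measurable_funX.
transitivity (\int[mu]_u \int[mu]_v H (u, v))%E.
  apply: ge0_ae_eq_integral => //.
  - exact: (measurable_fun_fubini_tonelli_F (m2 := mu) _ mL).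
  - exact: (measurable_fun_fubini_tonelli_F (m2 := mu) _ mH).
  - by move=> x _; apply: integral_ge0.
  - by move=> x _; apply: integral_ge0.
  (* The substitution v = |u| w degenerates at u = 0, so the inner integrals agree only off this
     null set. *)
  - exists [set 0]; split => //; first exact: lebesgue_measure_set1.
    move=> u /=; apply: contra_notP => /eqP u0 _.
    have u0' : 0 < `|u| by rewrite normr_gt0.
    rewrite (ge0_integral_scale _ _ u0')//; last first.
      by apply: (measurableT_comp mG); apply: measurable_funD.
    rewrite -ge0_integralZl//.
    + apply: eq_integral => v _; rewrite /H/=; congr (_ * G _)%E.
      by rewrite exprMn real_normK ?num_real// mulrDr mulr1.
    + apply: (measurableT_comp mG); apply: measurable_funD => //.
      by apply: measurable_funX; apply: measurable_funM.
transitivity (\int[mu]_w \int[mu]_u H (u, w))%E.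
  exact: (fubini_tonelli (m1 := mu) (m2 := mu) H mH H0).
pose g s : \bar R := (`|s|%:E * G (s ^+ 2)%R)%E.
have mg : measurable_fun [set: R] g.
  apply: emeasurable_funM; first by apply/measurable_EFinP.
  by apply: (measurableT_comp mG); exact: measurable_funX.
have g0 s : (0 <= g s)%E by apply: mule_ge0; rewrite ?lee_fin.
transitivity (\int[mu]_w (((1 + w ^+ 2)^-1)%:E * \int[mu]_s g s))%E.
  apply: eq_integral => w _.
  have w0 : 0 < 1 + w ^+ 2 by rewrite ltr_wpDr// sqr_ge0.
  have c0 : 0 < Num.sqrt (1 + w ^+ 2) by rewrite sqrtr_gt0.
  (* Substituting s = c u with c = sqrt (1 + w^2) gives one factor c from the measure and one from
     |s|; together they cancel 1 / (1 + w^2). *)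
  rewrite [in RHS](ge0_integral_scale _ _ c0 mg g0) muleA -EFinM.
  rewrite -ge0_integralZl//; last 2 first.
  - by apply: (measurableT_comp mg); apply: measurable_funM.
  - by rewrite lee_fin mulr_ge0// ?invr_ge0 ltW.
  apply: eq_integral => u _; rewrite /H/g/= exprMn sqr_sqrtr ?(ltW w0)//.
  rewrite normrM (gtr0_norm c0) muleA -EFinM (mulrC _ (u ^+ 2)).
  congr (_%:E * _)%E.
  rewrite mulrA -(mulrA _^-1) -expr2 sqr_sqrtr ?(ltW w0)//.
  by rewrite mulVf ?mul1r// gt_eqF.
rewrite ge0_integralZr//.
- by rewrite integralT_oneDsqrV.
- apply/measurable_EFinP.
  exact: (continuous_measurable_fun (@continuous_oneDsqrV R)).
- by move=> w _; rewrite lee_fin invr_ge0 addr_ge0// sqr_ge0.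
- exact: integral_ge0.
Qed.

End polar.

Section normal.
Context {R : realType}.
Local Notation mu := (@lebesgue_measure R).

(** The Radon-Nikodym derivative and [normal_pdf] have equal integrals over every measurable set, so
    they agree almost everywhere. *)
Lemma ge0_integral_normal_prob (m s : R) (f : R -> \bar R) :
  measurable_fun [set: R] f -> (forall x, 0 <= f x)%E ->
  (\int[normal_prob m s]_x f x =
   \int[mu]_x (f x * (normal_pdf m s x)%:E))%E.
Proof.
move=> mf f0.
have dom := normal_prob_dominates m s.
pose g := Radon_Nikodym_SigmaFinite.f (normal_prob m s) mu.
have ig : mu.-integrable setT g by exact: Radon_Nikodym_SigmaFinite.f_integrable.
have mp : measurable_fun setT (fun x => (normal_pdf m s x)%:E).
  by apply/measurable_EFinP; exact: measurable_normal_pdf.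
rewrite -(Radon_Nikodym_SigmaFinite.change_of_variables dom f0)//.
apply: ge0_ae_eq_integral => //.
- by apply: emeasurable_funM => //; exact: measurable_int ig.
- exact: emeasurable_funM.
- by move=> x _; rewrite mule_ge0 ?Radon_Nikodym_SigmaFinite.f_ge0.
- by move=> x _; rewrite mule_ge0 ?lee_fin ?normal_pdf_ge0.
apply: ae_eqe_mul2l => /=.
apply: integral_ae_eq => // E _ mE.
by rewrite -(Radon_Nikodym_SigmaFinite.f_integral dom).
Qed.

Lemma normal_pdf_half (x : R) :
  normal_pdf 0 (Num.sqrt 2^-1) x = (Num.sqrt pi)^-1 * expR (- x ^+ 2).
Proof.
have s2 : Num.sqrt (2^-1 : R) ^+ 2 = 2^-1 by rewrite sqr_sqrtr// invr_ge0.
have s0 : Num.sqrt (2^-1 : R) != 0 by rewrite gt_eqF// sqrtr_gt0 invr_gt0.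
rewrite normal_pdfE// /normal_peak /normal_fun s2 subr0.
by congr (( Num.sqrt _)^-1 * expR _); field.
Qed.

End normal.

Section law.
Context {R : realType}.
Local Notation mu := (@lebesgue_measure R).

Lemma ge0_integralT_even (f : R -> \bar R) :
  measurable_fun [set: R] f -> (forall x, 0 <= f x)%E ->
  (forall x, f (- x) = f x) ->
  (\int[mu]_x f x = \int[mu]_(x in `[0%R, +oo[) (2%:E * f x))%E.
Proof.
move=> mf f0 fN.
have mfD D : measurable_fun D f by exact: measurable_funS mf.
have -> : [set: R] = `]-oo, 0%R[%classic `|` `[0%R, +oo[%classic.
  by apply/esym/seteqP; split => // x _ /=; rewrite !in_itv/= andbT; case: (ltP x 0) => _; [left|right].
rewrite ge0_integral_setU//=; [|exact: mfD|].
  2: {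
  apply/disj_set2P/seteqP; split => // x /= [].
  by rewrite !in_itv/= andbT => x0; rewrite leNgt x0. }
rewrite integral_itv_bndo_bndc//.
have -> : (\int[mu]_(x in `]-oo, 0%R]) f x = \int[mu]_(x in `[0%R, +oo[) f x)%E.
  rewrite ge0_integration_by_substitution0//.
  by apply: eq_integral => x _; rewrite fN.
rewrite ge0_integralZl//; last exact: mfD.
by rewrite mule_natl mule2n.
Qed.

Local Notation nu := (normal_prob (0 : R) (Num.sqrt 2^-1)).

(** By independence the joint law of (U, V) is a product, whose density depends on u^2 + v^2 only,
    so polar integration applies. The factor pi cancels, and folding the line onto the half-line
    gives the 2. *)
Lemma ge0_integral_sqr_normal {d} {T : measurableType d} (P : probability T R)
    (U V : T -> R) (f : R -> \bar R) :
  measurable_fun setT U -> measurable_fun setT V ->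
  (forall A B, measurable A -> measurable B ->
    P (U @^-1` A `&` V @^-1` B) =
    (nu A * nu B)%E) ->
  measurable_fun [set: R] f -> (forall x, 0 <= f x)%E ->
  (\int[P]_w f (U w ^+ 2 + V w ^+ 2)%R =
   \int[mu]_(s in `[0%R, +oo[) ((2 * s * expR (- s ^+ 2))%:E * f (s ^+ 2)%R))%E.
Proof.
move=> mU mV UV mf f0.
pose phi w : measurableTypeR R * measurableTypeR R := (U w, V w).
have mphi : measurable_fun setT phi by exact/measurable_fun_pair.
pose g (z : measurableTypeR R * measurableTypeR R) := f (z.1 ^+ 2 + z.2 ^+ 2).
have mg : measurable_fun setT g.
  by apply: (measurableT_comp mf); apply: measurable_funD; exact: measurable_funX.
transitivity (\int[pushforward P phi]_z g z)%E.
  by rewrite (ge0_integral_pushforward mphi)// => z _; exact: f0.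
transitivity (\int[nu \x nu]_z g z)%E.
  apply/esym; rewrite (@eq_measure_integral _ _ _ setT (pushforward P phi) (nu \x nu)%E) //.
  move=> A mA _.
  by apply: product_measure_unique => // B C mB mC; rewrite -UV.
have mfu (u : R) : measurable_fun [set: R] (fun v => f (u ^+ 2 + v ^+ 2)).
  by apply: (measurableT_comp mf); apply: measurable_funD.
have g0 z : (0 <= g z)%E by exact: f0.
rewrite (fubini_tonelli1 g mg g0).
pose e (x : R) := (Num.sqrt pi)^-1 * expR (- x).
have nuE x : normal_pdf 0 (Num.sqrt 2^-1) x = e (x ^+ 2) by exact: normal_pdf_half.
(* The joint density exp(-(u^2 + v^2)) / pi is absorbed into the radial function. *)
pose G x := (f x * (pi^-1 * expR (- x))%:E)%E.
have mG : measurable_fun [set: R] G.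
  apply: emeasurable_funM => //.
  by apply/measurable_EFinP; apply: measurable_funM => //; apply: measurableT_comp.
transitivity (\int[mu]_u \int[mu]_v G (u ^+ 2 + v ^+ 2)%R)%E.
  rewrite ge0_integral_normal_prob; last 2 first.
  - exact: (measurable_fun_fubini_tonelli_F (m2 := nu) g mg g0).
  - by move=> x; apply: integral_ge0 => y _; exact: g0.
  apply: eq_integral => u _; rewrite /fubini_F ge0_integral_normal_prob//; last first.
    exact: mfu.
  rewrite -ge0_integralZr//.
  - apply: eq_integral => v _; rewrite /g/G/= -muleA -EFinM !nuE /e.
    congr (_ * _%:E)%E; rewrite opprD expRD mulrACA -invfM -expr2 sqr_sqrtr ?pi_ge0//.
    ring.
  - apply: emeasurable_funM.
      exact: mfu.
    by apply/measurable_EFinP; exact: measurable_normal_pdf.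
  - by move=> x _; rewrite mule_ge0// lee_fin normal_pdf_ge0.
  - by rewrite lee_fin normal_pdf_ge0.
rewrite ge0_integral_polar//; last first.
  by move=> x; rewrite mule_ge0// lee_fin mulr_ge0// ?expR_ge0// invr_ge0 pi_ge0.
pose K (x : R) := (`|x|%:E * G (x ^+ 2)%R)%E.
have mK : measurable_fun [set: R] K.
  apply: emeasurable_funM; first by apply/measurable_EFinP.
  by apply: (measurableT_comp mG); exact: measurable_funX.
have p0 : (pi : R) != 0 by rewrite gt_eqF// pi_gt0.
have K0 x : (0 <= K x)%E.
  by rewrite !mule_ge0// lee_fin mulr_ge0// ?expR_ge0// invr_ge0 pi_ge0.
rewrite (ge0_integralT_even K mK K0); last by move=> x; rewrite /K normrN sqrrN.
rewrite -ge0_integralZl//.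
- apply: eq_integral => s; rewrite inE/= in_itv/= andbT => s0.
  rewrite /K /G ger0_norm//.
  rewrite (muleC (f _)) !muleA -!EFinM; congr (_%:E * _)%E.
  by move: p0; move: (pi : R) => p p0; field.
- by apply: measurable_funS (_ : measurable_fun [set: R] _) => //; exact: emeasurable_funM.
- by move=> x _; rewrite mule_ge0.
- by rewrite lee_fin pi_ge0.
Qed.

End law.

Section explaw.
Context {R : realType}.
Local Notation mu := (@lebesgue_measure R).

Lemma integral_quad_expR (a c0 c1 c2 : R) : 0 <= a ->
  (\int[mu]_(s in `[0%R, Num.sqrt a])
     (2 * s * expR (- s ^+ 2) *
      ((c0 + c1) + (c1 + 2 * c2) * (a - s ^+ 2) + c2 * (a - s ^+ 2) ^+ 2))%:E =
   (c0 + c1 * a + c2 * a ^+ 2 - c0 * expR (- a))%:E)%E.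
Proof.
rewrite le_eqVlt => /predU1P[<-|a0].
  by rewrite sqrtr0 set_itv1 integral_set1 !(mulr0, expr0n, addr0, oppr0) expR0 mulr1 subrr.
have sa : 0 < Num.sqrt a by rewrite sqrtr_gt0.
(* With g x = c0 + c1 x + c2 x^2, this antiderivative is - g(a - s^2) exp(- s^2). *)
pose F (s : R) : R := - ((c0 + c1 * (a - s ^+ 2) + c2 * (a - s ^+ 2) ^+ 2) * expR (- s ^+ 2)).
pose f (s : R) : R := (2 * s * expR (- s ^+ 2) *
      ((c0 + c1) + (c1 + 2 * c2) * (a - s ^+ 2) + c2 * (a - s ^+ 2) ^+ 2)).
have dF (s : R) : is_derive s 1 F (f s).
  by rewrite /F /f; apply: is_derive_eq; rewrite /GRing.scale/=; ring.
have cF : continuous F.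
  by move=> s; apply/differentiable_continuous/derivable1_diffP; exact: ex_derive.
have cf : continuous f.
  by move=> s; apply/differentiable_continuous/derivable1_diffP; rewrite /f; exact: ex_derive.
rewrite (@continuous_FTC2 _ f F)//.
- rewrite /F sqr_sqrtr ?(ltW a0)// subrr !(mulr0, expr0n, addr0, oppr0, subr0)/= expR0.
  rewrite -EFinB; congr EFin; ring.
- exact: continuous_subspaceT.
- split.
  + by move=> x _; exact: ex_derive.
  + by apply: cvg_at_right_filter; exact: cF.
  + by apply: cvg_at_left_filter; exact: cF.
- by move=> x _; rewrite derive1E; exact: derive_val.
Qed.

(* X is Exp(1)-distributed; the density is written in the variable s = sqrt x,
   which is how it comes out of the polar integral. *)
Definition exp_law {d} {T : measurableType d} (P : probability T R) (X : T -> R) :=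
  forall f : R -> \bar R, measurable_fun [set: R] f -> (forall x, 0 <= f x)%E ->
  (\int[P]_w f (X w) =
   \int[mu]_(s in `[0%R, +oo[) ((2 * s * expR (- s ^+ 2))%:E * f (s ^+ 2)%R))%E.

(* With g x = c0 + c1 x + c2 x^2 the integrand is (g + g')(a - X) on {X <= a}
   and the value is g a - g 0 * exp (- a). *)
Lemma exp_law_quad {d} {T : measurableType d} (P : probability T R) (X : T -> R)
    (a c0 c1 c2 : R) :
  exp_law P X -> 0 <= a -> 0 <= c0 -> 0 <= c1 -> 0 <= c2 ->
  (\int[P]_w ((X w <= a)%R%:R *
      ((c0 + c1) + (c1 + 2 * c2) * (a - X w) + c2 * (a - X w) ^+ 2))%:E =
   (c0 + c1 * a + c2 * a ^+ 2 - c0 * expR (- a))%:E)%E.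
Proof.
move=> XP a0 c00 c10 c20.
rewrite -integral_quad_expR//.
pose f (x : R) : \bar R := ((x <= a)%R%:R *
  ((c0 + c1) + (c1 + 2 * c2) * (a - x) + c2 * (a - x) ^+ 2))%:E.
have mf : measurable_fun [set: R] f.
  apply/measurable_EFinP.
  rewrite [X in measurable_fun _ X](_ : _ = fun x => \1_`]-oo, a]%classic x *
    ((c0 + c1) + (c1 + 2 * c2) * (a - x) + c2 * (a - x) ^+ 2)).
    apply: measurable_funM; first exact: measurable_indic.
    have mB : measurable_fun [set: R] (fun x => a - x) by exact: measurable_funB.
    by apply: measurable_funD; [apply: measurable_funD => //|];
      apply: measurable_funM => //; exact: measurable_funX.
  by apply/funext => x; rewrite indicE mem_setE in_itv.
have f0 x : (0 <= f x)%E.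
  rewrite lee_fin; case: (leP x a) => xa; last by rewrite mul0r.
  rewrite -subr_ge0 in xa; rewrite mul1r addr_ge0 ?addr_ge0 ?(mulr_ge0 c20) ?sqr_ge0//.
  by rewrite mulr_ge0// addr_ge0// mulr_ge0.
rewrite (XP f mf f0) integral_mkcond [RHS]integral_mkcond.
apply: eq_integral => s _; rewrite !patchE !mem_setE !in_itv/= andbT.
case: (leP 0 s) => //= s0; rewrite /f.
have -> : (s ^+ 2 <= a) = (s <= Num.sqrt a).
  by rewrite -{1}(sqr_sqrtr a0) ler_sqr ?nnegrE ?sqrtr_ge0.
by case: (s <= _); rewrite -EFinM ?mul1r// mul0r mulr0.
Qed.

Lemma exp_law_cdf {d} {T : measurableType d} (P : probability T R) (X : T -> R)
    (a : R) : measurable_fun setT X ->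
  exp_law P X -> 0 <= a -> P (X @^-1` `]-oo, a]%classic) = (1 - expR (- a))%:E.
Proof.
move=> mX XP a0.
have mA : measurable (X @^-1` `]-oo, a]%classic).
  by rewrite -[X in measurable X]setTI; exact: mX.
(* Here g is the constant 1. *)
have := @exp_law_quad _ _ P X a 1 0 0 XP a0 ler01 (lexx _) (lexx _).
rewrite !(mul0r, addr0, mul1r) => <-.
rewrite -[X in P X]setIT -integral_indic//.
apply: eq_integral => w _; rewrite indicE !(mulr0, mul0r, addr0, mulr1); congr ((nat_of_bool _)%:R%:E).
by apply/idP/idP; rewrite inE/= in_itv/=.
Qed.

(** The density is at most 1: exp(-b) - exp(-c) = exp(-b) (1 - exp(b - c)) <= c - b. Negative
    endpoints are treated apart because the distribution function is available only on the
    half-line. *)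
Lemma exp_law_itv {d} {T : measurableType d} (P : probability T R) (X : T -> R)
    (b c : R) : measurable_fun setT X -> (forall w, 0 <= X w) ->
  exp_law P X -> b <= c -> (P (X @^-1` `]b, c]%classic) <= (c - b)%:E)%E.
Proof.
move=> mX X0 XP bc.
have mI (A : set R) : measurable A -> measurable (X @^-1` A).
  by move=> mA; rewrite -[Y in measurable Y]setTI; exact: mX.
have [c0|c0] := ltP c 0.
  rewrite (_ : _ @^-1` _ = set0) ?measure0 ?lee_fin ?subr_ge0//.
  apply/seteqP; split => // w /=; rewrite in_itv/= => /andP[_ Xc].
  by have := lt_le_trans c0 (X0 w); rewrite ltNge Xc.
have [b0|b0] := ltP b 0.
  apply: (@le_trans _ _ (P (X @^-1` `]-oo, c]%classic))).
    apply: le_measure; rewrite ?inE; [exact: mI|exact: mI|].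
    by move=> w /=; rewrite !in_itv/= => /andP[].
  rewrite exp_law_cdf// lee_fin.
  have := expR_ge1Dx (- c); lra.
rewrite (_ : _ @^-1` _ = X @^-1` `]-oo, c]%classic `\` X @^-1` `]-oo, b]%classic); last first.
  apply/seteqP; split => w /=; rewrite !in_itv/=.
    by move=> /andP[bX ->]; split => //; apply/negP; rewrite -ltNge.
  by move=> [-> /negP]; rewrite -ltNge andbT.
have -> : P (X @^-1` `]-oo, c]%classic `\` X @^-1` `]-oo, b]%classic) =
    (P (X @^-1` `]-oo, c]%classic) - P (X @^-1` `]-oo, b]%classic))%E.
  rewrite measureD; [|exact: mI|exact: mI|].
    congr (_ - P _)%E.
    by apply/setIidr => w /=; rewrite !in_itv/= => Xb; exact: le_trans bc.
  by rewrite ltey_eq fin_num_measure//; exact: mI.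
rewrite !exp_law_cdf// -EFinB lee_fin.
have -> : expR (- c) = expR (- b) * expR (b - c) by rewrite -expRD; congr expR; ring.
have h1 := expR_ge1Dx (b - c).
have h2 : expR (- b) <= 1 by rewrite -expR0 ler_expR oppr_le0.
have h3 := expR_gt0 (- b).
nra.
Qed.

End explaw.

(** * Independence from a generating pi-system, and conditioning on one of two independent
    variables *)

Section independence.
Context {d} {T : measurableType d} {R : realType} (P : probability T R).

(** In A, both sides are finite measures that agree on the pi-system [G], so they agree on the
    sigma-algebra it generates. *)
Lemma indep_sigma (G : set (set T)) (E : set T) :
  G `<=` measurable -> setI_closed G -> G setT -> measurable E ->
  (forall A, G A -> P (A `&` E) = (P A * P E)%E) ->
  forall A, <<s G >> A -> P (A `&` E) = (P A * P E)%E.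
Proof.
move=> Gm GI GT mE GE A sA.
have PE0 : 0 <= fine (P E) by rewrite fine_ge0.
pose m2 := mscale (NngNum PE0) P.
rewrite [RHS](_ : _ = m2 A); last first.
  by rewrite /m2/mscale/= fineK ?fin_num_measure// muleC.
apply: (@g_sigma_algebra_measure_unique _ R T G Gm (fun=> setT) _ _ (mrestr P mE) m2) => //.
- by rewrite bigcup_const.
- move=> B GB; rewrite -[RHS]/((fine (P E))%:E * P B)%E fineK ?fin_num_measure// muleC.
  exact: GE.
- by move=> _; rewrite ltey_eq fin_num_measure.
Qed.

(** The joint law is the product of the two distributions, and a product measure is the integral of
    the measures of sections. This serves as conditioning on [X]. *)
Lemma indep_pair (X S : T -> R) (D : set (R * R)) :
  measurable_fun setT X -> measurable_fun setT S ->
  (forall A B, measurable A -> measurable B ->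
    P (X @^-1` A `&` S @^-1` B) = (P (X @^-1` A) * P (S @^-1` B))%E) ->
  measurable D ->
  P [set w | D (X w, S w)] = (\int[P]_w P [set w' | D (X w, S w')])%E.
Proof.
move=> mX mS XS mD.
pose X' : {mfun T >-> R} := mfun_Sub (mem_set mX : X \in mfun).
pose S' : {mfun T >-> R} := mfun_Sub (mem_set mS : S \in mfun).
have mphi : measurable_fun setT (fun w => (X w, S w)) by exact/measurable_fun_pair.
transitivity ((distribution P X' \x distribution P S')%E D).
  apply/esym.
  apply: (@product_measure_unique _ _ _ _ _ _ _ (pushforward P (fun w => (X w, S w)))) => //.
rewrite [LHS]/product_measure1/=.
rewrite (ge0_integral_pushforward mX)//.
  apply: eq_integral => w _; rewrite /=/distribution/pushforward; congr (P _).
  by apply/seteqP; split => x /=; rewrite /xsection/= inE.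
exact: measurable_fun_xsection.
Qed.

End independence.

(** * Quantization and the stopping rule *)

Section complex_gain.
Context {R : realType}.
Implicit Types z x : R[i].

Lemma Re_sum (I : finType) (F : I -> R[i]) :
  complex.Re (\sum_i F i) = \sum_i complex.Re (F i).
Proof. by apply: (big_morph (@complex.Re R) (id1 := 0)) => // -[a b] [c e]. Qed.

Lemma sqr_normc (z : R[i]) : normc z ^+ 2 = complex.Re z ^+ 2 + complex.Im z ^+ 2.
Proof. by case: z => a b /=; rewrite sqr_sqrtr// addr_ge0// sqr_ge0. Qed.

Lemma divr_real_complex (z : R[i]) (s : R) :
  z / (real_complex R s) = Complex (complex.Re z / s) (complex.Im z / s).
Proof.
rewrite -fmorphV; case: z => a b; rewrite /real_complex_def.
by rewrite /GRing.mul/= !mulr0 subr0 add0r.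
Qed.

Lemma gain_beamF (t : nat) (h : 'I_t -> R[i]) : gain (beamF h) h = nrm2 h t.
Proof.
have n0 : 0 <= nrm2 h t by apply: sumr_ge0 => k _; exact: sqr_ge0.
set c := (Num.sqrt (nrm2 h t))^-1.
have -> : gain (beamF h) h = normc (real_complex R (c * nrm2 h t)) ^+ 2.
  congr (normc _ ^+ 2); rewrite /nrm2 mulr_sumr rmorph_sum/=.
  rewrite [RHS](eq_bigl xpredT); last by move=> k; rewrite ltn_ord.
  apply: eq_bigr => k _; rewrite /beamF divr_real_complex sqr_normc.
  rewrite -/c; case: (h k) => a b /=.
  by apply/eqP; rewrite eq_complex/=; apply/andP; split; apply/eqP; rewrite /c; ring.
rewrite sqr_normc/= expr0n addr0 exprMn /c exprVn sqr_sqrtr//.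
(* For a zero channel the inverse is 0 by convention, and both sides vanish. *)
have [->|nn0] := eqVneq (nrm2 h t) 0; first by rewrite expr0n mulr0.
by rewrite expr2 mulrA mulVf// mul1r.
Qed.

(** Rounding towards 0 keeps the sign and shortens |y| by less than one step 2^-(l+1); multiply by
    |y|. *)
Lemma qr_ge (y : R) (l : int) :
  y ^+ 2 - `|y| * (2 : R) ^ (- (l + 1)) <= qr y l * y.
Proof.
rewrite /qr; set e := 2 ^ _; set f := Num.floor _.
have e0 : 0 < e by rewrite exprz_gt0.
have eV : (2 : R) ^ (l + 1) = e^-1 by rewrite /e invr_expz opprK.
have fl : `|y| / e < f%:~R + 1 by have := floorD1_gt (`|y| / e); rewrite intrD /f eV.
have -> : Num.sg y * e * f%:~R * y = `|y| * (e * f%:~R) by rewrite [in RHS]normrEsg; ring.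
have -> : y ^+ 2 - `|y| * e = `|y| * (`|y| - e) by rewrite -[y ^+ 2]real_normK ?num_real//; ring.
apply: ler_wpM2l => //.
have : `|y| < (f%:~R + 1) * e by rewrite -ltr_pdivrMr.
lra.
Qed.

Lemma log2_le_exprz (y : R) (l : int) : 0 < y -> log2 y <= l%:~R -> y <= 2 ^ l.
Proof.
move=> y0; rewrite /log2 => h.
have l2 : 0 < ln (2 : R) by rewrite ln_gt0// ltr1n.
rewrite -powR_intmul// -ler_ln ?posrE ?powR_gt0// ln_powR.
by rewrite -ler_pdivrMr.
Qed.

End complex_gain.

Section quantized_beam.
Context {R : realType} (t : nat) (alpha : R) (h : 'I_t -> R[i]).
Hypothesis alpha0 : 0 < alpha.

(** One bound for each branch of the maximum in [Lq]; i 2^-L will be the relative loss of amplitude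
    caused by quantization. *)
Lemma Lq_ge (i : nat) : (0 < i)%N -> alpha < nrm2 h i ->
  i%:R * (2 : R) ^ (- (Lq alpha h i)) <= 4^-1 /\
  i%:R * (2 : R) ^ (- (Lq alpha h i)) <= (nrm2 h i - alpha) / (4 * alpha).
Proof.
move=> i0 ai; set L := Lq _ _ _.
have i0' : 0 < i%:R :> R by rewrite ltr0n.
have d0 : 0 < nrm2 h i - alpha by rewrite subr_gt0.
have p0 : 0 < (2 : R) ^ L by rewrite exprz_gt0.
have h1 : 4 * i%:R <= (2 : R) ^ L.
  apply: log2_le_exprz; first by rewrite mulr_gt0.
  by apply: le_trans (ceil_ge _) _; rewrite ler_int /L /Lq le_max lexx.
have h2 : 4 * i%:R * alpha / (nrm2 h i - alpha) <= (2 : R) ^ L.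
  apply: log2_le_exprz; first by rewrite divr_gt0// !mulr_gt0.
  by apply: le_trans (ceil_ge _) _; rewrite ler_int /L /Lq le_max lexx orbT.
rewrite -invr_expz; move: p0 h1 h2; move: ((2 : R) ^ L) => p p0 h1 h2; split.
  by rewrite ler_pdivrMr//; lra.
rewrite ler_pdivrMr// mulrAC ler_pdivlMr ?mulr_gt0//.
by move: h2; rewrite ler_pdivrMr//; lra.
Qed.

(** The modulus of the inner product is at least its real part, which quantization brings down from
    s = sqrt n to no less than s (1 - e), where e = i 2^-L. *)
Lemma gain_beamD_exceed : exceedD alpha h -> alpha < nrm2 h (stopD alpha h) ->
  alpha <= gain (beamD alpha h) h.
Proof.
move=> ex; set i := stopD alpha h => ai.
have i0 : (0 < i)%N by rewrite /i /stopD ex.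
have [L1 L2] := Lq_ge i i0 ai; set L := Lq alpha h i in L1 L2.
set e := i%:R * (2 : R) ^ (- L) in L1 L2.
set n := nrm2 h i in ai L1 L2 *.
have n0 : 0 < n by exact: lt_trans ai.
set s := Num.sqrt n.
have s0 : 0 < s by rewrite sqrtr_gt0.
have s2 : s ^+ 2 = n by rewrite sqr_sqrtr// ltW.
pose dl : R := 2 ^ (- (L + 1)).
have dl0 : 0 < dl by rewrite exprz_gt0.
have dlE : 2 * i%:R * dl = e.
  rewrite /dl /e opprD expfzDr// exprN1; move: ((2 : R) ^ (- L)) => p.
  have t2 : (2 : R) / 2 = 1 by rewrite divff.
  by rewrite [LHS](_ : _ = (i%:R * p) * (2 / 2)); [rewrite t2 mulr1|ring].
have qle (y : R) : y ^+ 2 - `|y| * dl <= qr y L * y by exact: qr_ge.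
clearbody e dl.
pose a (k : 'I_t) := complex.Re (h k) / s.
pose b (k : 'I_t) := complex.Im (h k) / s.
have ab1 : \sum_(k < t | (k < i)%N) (a k ^+ 2 + b k ^+ 2) = 1.
  transitivity (n / n); last by rewrite divff// gt_eqF.
  rewrite {1}/n /nrm2 mulr_suml; apply: eq_bigr => k _.
  by rewrite sqr_normc /a /b !exprMn -mulrDl exprVn s2.
have ReE : complex.Re (\sum_(k < t) ((beamD alpha h k)^* * h k)%C) =
   s * \sum_(k < t | (k < i)%N) (qr (a k) L * a k + qr (b k) L * b k).
  rewrite Re_sum mulr_sumr [RHS]big_mkcond/=; apply: eq_bigr => k _.
  rewrite /beamD ex -/i; case: ifP => ki; last first.
    by case: (h k) => x y /=; rewrite oppr0 !mul0r subr0.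
  rewrite divr_real_complex -/n -/s -/L /qc/= -/(a k) -/(b k).
  have -> : h k = Complex (s * a k) (s * b k).
    by rewrite /a /b; case: (h k) => x y /=; congr Complex; field; rewrite gt_eqF.
  rewrite /=; ring.
(* From |y| <= (y^2 + 1) / 2 and the unit norm, the sum is at most 1/2 + i <= 2 i. *)
have Sle : \sum_(k < t | (k < i)%N) (`|a k| + `|b k|) <= 2 * i%:R.
  apply: (@le_trans _ _ (\sum_(k < t | (k < i)%N) ((a k ^+ 2 + b k ^+ 2) / 2 + 1))).
    apply: ler_sum => k _.
    have h1 : 0 <= (`|a k| - 1) ^+ 2 by exact: sqr_ge0.
    have h2 : 0 <= (`|b k| - 1) ^+ 2 by exact: sqr_ge0.
    rewrite -[a k ^+ 2]real_normK ?num_real// -[b k ^+ 2]real_normK ?num_real//.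
    rewrite !sqrrB1 in h1 h2. lra.
  rewrite big_split/= -mulr_suml ab1 mul1r.
  have : \sum_(k < t | (k < i)%N) (1 : R) <= i%:R.
    rewrite sumr_const; rewrite ler_nat.
    rewrite cardE; apply: leq_trans (_ : size (iota 0 i) <= i)%N; last by rewrite size_iota.
    rewrite -(size_map val); apply: uniq_leq_size.
      by rewrite map_inj_uniq ?enum_uniq//; exact: val_inj.
    by move=> x /mapP[k]; rewrite mem_enum => ki ->; rewrite mem_iota.
  have : 1 <= i%:R :> R by rewrite ler1n.
  lra.
have key : s * (1 - e) <= complex.Re (\sum_(k < t) ((beamD alpha h k)^* * h k)%C).
  rewrite ReE ler_pM2l//.
  apply: (@le_trans _ _ (\sum_(k < t | (k < i)%N)
     ((a k ^+ 2 + b k ^+ 2) - (`|a k| + `|b k|) * dl))).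
    rewrite sumrB ab1 -mulr_suml lerB//.
    by rewrite -dlE ler_pM2r.
  apply: ler_sum => k _.
  have := qle (a k); have := qle (b k); lra.
have e1 : 0 <= 1 - e by lra.
rewrite /gain sqr_normc.
apply: (@le_trans _ _ ((s * (1 - e)) ^+ 2)); last first.
  rewrite ler_wpDr ?sqr_ge0// ler_sqr// nnegrE.
    by rewrite mulr_ge0// ltW.
  by apply: le_trans key; rewrite mulr_ge0// ltW.
rewrite exprMn s2.
have e2 : e * (4 * alpha) <= n - alpha by rewrite -ler_pdivlMr// mulr_gt0.
(* If n >= 2 alpha, then e <= 1/4 gives n (1 - e)^2 >= 9 n / 16 > alpha. Otherwise e <= (n - alpha)
   / (4 alpha) gives n (1 - 2 e) >= n - (n - alpha) = alpha. *)
have [na|na] := leP (2 * alpha) n; nra.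
Qed.

End quantized_beam.

(** * Stopping index and feedback length along a fixed channel *)

Section stopping.
Context {R : realType} (t : nat) (alpha : R) (h : 'I_t -> R[i]).
Hypotheses (t0 : (0 < t)%N) (alpha0 : 0 < alpha).

Lemma nrm2_nd i j : (i <= j)%N -> nrm2 h i <= nrm2 h j.
Proof.
move=> ij; rewrite /nrm2 [leLHS]big_mkcond [leRHS]big_mkcond/=.
apply: ler_sum => k _; case: ifPn => ki; last by case: ifP => // _; exact: sqr_ge0.
by rewrite (leq_trans ki ij).
Qed.

Lemma nrm2_0 : nrm2 h 0 = 0.
Proof. by rewrite /nrm2 big_pred0. Qed.

Lemma firstD_le_size : (firstD alpha h <= t)%N.
Proof. by rewrite /firstD; apply: leq_trans (find_size _ _) _; rewrite size_iota. Qed.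

(** As the norms are nondecreasing, not having stopped yet is a condition on a single norm. Position
    j of the list holds the index j + 1. *)
Lemma ltn_firstD j : (j < t)%N -> (j < firstD alpha h)%N = (nrm2 h j.+1 <= alpha).
Proof.
move=> jt; apply/idP/idP => [jf|].
  have := before_find 0%N jf; rewrite nth_iota// add1n => /negbT.
  by rewrite -leNgt.
apply: contraLR; rewrite -leqNgt -ltNge => fj.
have ft : (firstD alpha h < t)%N by exact: leq_ltn_trans fj jt.
have hs : has (fun i => alpha < nrm2 h i) (iota 1 t) by rewrite has_find size_iota.
have := nth_find 0%N hs; rewrite nth_iota// add1n => /lt_le_trans; apply.
exact: nrm2_nd.
Qed.

(* Turns a function of the stopping index into a sum of the indicators of
   {S_i <= alpha}, whose expectations are the renewal probabilities. *)
Lemma stopD_telescope (g : nat -> R) :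
  g (stopD alpha h) = g 1%N +
    \sum_(j < t.-1) (g j.+2 - g j.+1) * (nrm2 h j.+1 <= alpha)%R%:R.
Proof.
(* Without exceedance [firstD] is [t]; the cap at t - 1 merges this case with a stop at the last
   antenna. *)
have -> : stopD alpha h = (minn (firstD alpha h) t.-1).+1.
  rewrite /stopD /exceedD; have := firstD_le_size; case: ltnP => ft fs.
    by rewrite (minn_idPl _)// -ltnS prednK.
  by rewrite (minn_idPr _) ?prednK// (leq_trans (leq_pred t)).
rewrite (eq_bigr (fun j : 'I_t.-1 => (g j.+2 - g j.+1) * (j < firstD alpha h)%N%:R)); last first.
  move=> j _; rewrite ltn_firstD//.
  by rewrite (leq_trans (ltn_ord j))// leq_pred.
elim: (t.-1) => [|n IH]; first by rewrite big_ord0 minn0 addr0.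
rewrite big_ord_recr/= addrA -IH; have [nf|nf] := boolP (n < firstD alpha h)%N.
  by rewrite (minn_idPr nf) (minn_idPr (ltnW nf)) mulr1; ring.
rewrite -leqNgt in nf; by rewrite (minn_idPl nf) (minn_idPl (leqW nf)) mulr0 addr0.
Qed.

Lemma exceedD_crossing : exceedD alpha h ->
  nrm2 h (firstD alpha h) <= alpha < nrm2 h (firstD alpha h).+1.
Proof.
move=> ex; apply/andP; split; last by rewrite ltNge -ltn_firstD// ltnn.
case E : (firstD alpha h) => [|k]; first by rewrite nrm2_0 ltW.
by rewrite -ltn_firstD ?E// -E (leq_trans _ (ltnW ex)) ?E.
Qed.

Lemma nexceedD_le : ~~ exceedD alpha h -> nrm2 h t <= alpha.
Proof.
rewrite /exceedD -leqNgt => tf.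
by rewrite -{2}(prednK t0) -ltn_firstD ?prednK.
Qed.

(** Amounts to 4 i <= 2^(i+1), by induction. A bound linear in i keeps the feedback length quadratic
    in i. *)
Lemma log2_natmul4_le (i : nat) : (0 < i)%N -> log2 (4 * i%:R : R) <= (i.+1)%:R.
Proof.
move=> i0; have l2 : 0 < ln (2 : R) by rewrite ln_gt0// ltr1n.
rewrite /log2 ler_pdivrMr// -ln_powR ler_ln ?posrE ?powR_gt0 ?mulr_gt0 ?ltr0n//.
rewrite powR_mulrn// -natrX -natrM ler_nat.
case: i i0 => // i _; elim: i => // i IH; rewrite expnS; lia.
Qed.

Lemma log2_natmul4_ge0 (i : nat) : (0 < i)%N -> 0 <= log2 (4 * i%:R : R).
Proof.
move=> i0; rewrite divr_ge0 ?ln_ge0 ?ler1n// -natrM ler1n muln_gt0.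
by rewrite i0.
Qed.

Lemma Lq_ge0 (i : nat) : (0 < i)%N -> 0 <= Lq alpha h i.
Proof.
by move=> i0; rewrite /Lq le_max ceil_ge0 (lt_le_trans _ (log2_natmul4_ge0 i i0))// ltrN10.
Qed.

(** With r = alpha / (n - alpha), the logarithm of 4 i r splits into log2 (4 i) <= i + 1 and log2 r.
    Take the least [N] with r < 2^N: minimality gives 2^m <= r for m < N, which is the stated bound
    on n. *)
Lemma Lq_le (i : nat) : (0 < i)%N -> alpha < nrm2 h i ->
  exists N : nat, (forall m, (m < N)%N -> nrm2 h i <= alpha + alpha / 2 ^+ m) /\
    (Lq alpha h i)%:~R <= (i.+1 + N)%:R :> R.
Proof.
move=> i0 ai; set n := nrm2 h i in ai *.
have d0 : 0 < n - alpha by rewrite subr_gt0.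
have l2 : 0 < ln (2 : R) by rewrite ln_gt0// ltr1n.
have i0' : 0 < i%:R :> R by rewrite ltr0n.
pose r := alpha / (n - alpha).
have r0 : 0 < r by rewrite divr_gt0.
have exN : exists N, r < 2 ^+ N.
  exists (Num.trunc r).+1; rewrite -natrX.
  apply: lt_le_trans (truncnS_gt r) _.
  by rewrite ler_nat ltnW// ltn_expl.
case: (ex_minnP exN) => N rN minN; exists N; split => [m mN|].
  have : 2 ^+ m <= r by rewrite leNgt; apply: contraL mN => /minN; rewrite -leqNgt.
  rewrite /r ler_pdivlMr// => h1.
  have p0 : 0 < (2 : R) ^+ m by rewrite exprn_gt0.
  by rewrite -lerBlDl ler_pdivlMr// mulrC.
have h4 := log2_natmul4_le i i0.
rewrite /Lq -/n.
rewrite -[leRHS]/((Posz (i.+1 + N))%:~R) ler_int.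
rewrite ge_max !ceil_le_int; apply/andP; split.
  by apply: le_trans h4 _; rewrite -pmulrn ler_nat leq_addr.
have q0 : 0 < 4 * i%:R :> R by rewrite mulr_gt0.
rewrite -mulrA -/r /log2 lnM ?posrE// mulrDl.
rewrite -pmulrn natrD; apply: lerD => //.
rewrite ler_pdivrMr// -ln_powR ler_ln ?posrE ?powR_gt0// powR_mulrn//.
exact: ltW.
Qed.

(* c i = (i - 1) + 2 i ((i + 1) + 3), the feedback of a stop at i with L = i + 1. *)
Let c (i : nat) : R := 2 * i%:R ^+ 2 + 9 * i%:R - 1.

(** [N] counts the dyadic levels above alpha that the crossing norm does not exceed. Without
    exceedance [N] is 0, and the t bits are fewer than [c t]. *)
Lemma feedbackD_le : exists N : nat,
  (forall m, (m < N)%N -> exceedD alpha h /\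
     nrm2 h (firstD alpha h).+1 <= alpha + alpha / 2 ^+ m) /\
  0 <= feedbackD alpha h <= c (stopD alpha h) + (2 * (firstD alpha h).+1%:R * N%:R).
Proof.
rewrite /feedbackD; case: ifPn => ex; last first.
  exists 0%N; split => //; rewrite /stopD (negbTE ex) mulr0 addr0 ler0n/= /c.
  have : 1 <= t%:R :> R by rewrite ler1n.
  by nra.
have /andP[_ ai] := exceedD_crossing ex.
have [N [hN LN]] := Lq_le _ (ltn0Sn _) ai.
exists N; split; first by move=> m mN; split => //; exact: hN.
rewrite /stopD ex /c; set k := firstD alpha h in LN *.
have L0 := Lq_ge0 k.+1 (ltn0Sn _).
have L0' : 0 <= (Lq alpha h k.+1)%:~R :> R by rewrite ler0z.
rewrite intrD natrM/=; set L := (Lq _ _ _)%:~R in LN L0' *.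
rewrite natrD -!natr1 in LN *.
have k0 : 0 <= k%:R :> R by [].
have N0 : 0 <= N%:R :> R by [].
apply/andP; split; first by rewrite addr_ge0// mulr_ge0// ?addr_ge0.
have -> : 3%:~R = 3 :> R by [].
by nra.
Qed.

End stopping.

(** * Independence of the partial sums and the next entry *)

Section gaussian_vector.
Context {d} {T : measurableType d} {R : realType} (P : probability T R) (t : nat).
Variable hv : 'I_t -> T -> R[i].
Hypothesis CN : is_CN_std P hv.

Local Notation U k := (fun w => complex.Re (hv k w)).
Local Notation V k := (fun w => complex.Im (hv k w)).
Local Notation nu := (normal_prob (0 : R) (Num.sqrt 2^-1)).

Definition cylinder (A B : 'I_t -> set R) : set T :=
  \bigcap_(k in [set: 'I_t]) (U k @^-1` A k `&` V k @^-1` B k).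

(* Events that constrain only the entries with index in J. *)
Definition cylinders (J : pred 'I_t) : set (set T) :=
  [set C | exists A B, [/\ forall k, measurable (A k) /\ measurable (B k),
     forall k, ~~ J k -> A k = setT /\ B k = setT & C = cylinder A B]].

(** A copy of [T] with a smaller sigma-algebra, so that depending only on the entries in [J] becomes
    ordinary measurability. *)
Definition sigmaJ (J : pred 'I_t) : Type := g_sigma_algebraType (cylinders J).

Lemma measurable_cylinder A B :
  (forall k, measurable (A k) /\ measurable (B k)) -> measurable (cylinder A B).
Proof.
move=> mAB; apply: fin_bigcap_measurable; first exact: finite_finset.
move=> k _; have [mA mB] := mAB k; have [mU mV] := CN.1 k.
by apply: measurableI; rewrite -[X in measurable X]setTI; [exact: mU|exact: mV].
Qed.

Lemma cylinders_measurable J : cylinders J `<=` measurable.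
Proof. by move=> _ [A [B [mAB _ ->]]]; exact: measurable_cylinder. Qed.

Lemma cylinderI A B A' B' : cylinder A B `&` cylinder A' B' =
  cylinder (fun k => A k `&` A' k) (fun k => B k `&` B' k).
Proof.
apply/seteqP; split => w.
  by move=> [h h'] k _; have [? ?] := h k I; have [? ?] := h' k I.
by move=> h; split => k _; have [[? ?] [? ?]] := h k I.
Qed.

Lemma cylindersI J : setI_closed (cylinders J).
Proof.
move=> _ _ [A [B [mAB AB ->]]] [A' [B' [mAB' AB' ->]]]; rewrite cylinderI.
exists (fun k => A k `&` A' k), (fun k => B k `&` B' k); split => // k.
  by have [? ?] := mAB k; have [? ?] := mAB' k; split; exact: measurableI.
by move=> Jk; have [-> ->] := AB k Jk; have [-> ->] := AB' k Jk; rewrite !setIT.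
Qed.

Lemma cylindersT J : cylinders J setT.
Proof.
exists (fun=> setT), (fun=> setT); split => //.
by apply/esym/seteqP; split.
Qed.

(** Each index is constrained by at most one of the two events, and an unconstrained factor is
    [nu setT], that is 1; the product formula therefore splits index by index. *)
Lemma indep_cylinders (J J' : pred 'I_t) C C' :
  (forall k, J k -> ~~ J' k) -> cylinders J C -> cylinders J' C' ->
  P (C `&` C') = (P C * P C')%E.
Proof.
move=> JJ' [A [B [mAB AB ->]]] [A' [B' [mAB' AB' ->]]]; rewrite cylinderI.
have nuT : fine (nu setT) = 1 by rewrite probability_setT.
rewrite !CN.2//; last first.
  by move=> k; have [? ?] := mAB k; have [? ?] := mAB' k; split; exact: measurableI.
rewrite -EFinM -big_split; congr EFin; apply: eq_bigr => k _ /=.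
case: (boolP (J k)) => Jk.
  by have [-> ->] := AB' k (JJ' k Jk); rewrite !setIT !nuT !mulr1.
by have [-> ->] := AB k Jk; rewrite !setTI !nuT !mul1r.
Qed.

(** [indep_sigma] is applied twice: it reduces first [C], then [C'], to a cylinder. *)
Lemma indep_sigmaJ (J J' : pred 'I_t) C C' :
  (forall k, J k -> ~~ J' k) -> <<s cylinders J >> C -> <<s cylinders J' >> C' ->
  P (C `&` C') = (P C * P C')%E.
Proof.
move=> JJ' sC sC'.
have mC' : measurable C'.
  by apply: (smallest_sub (@sigma_algebra_measurable _ T) _) sC'; exact: cylinders_measurable.
apply: (indep_sigma P (cylinders J)) => //.
- exact: cylinders_measurable.
- exact: cylindersI.
- exact: cylindersT.
move=> A JA; rewrite setIC muleC.
have mA := cylinders_measurable _ _ JA.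
apply: (indep_sigma P (cylinders J')) => //.
- exact: cylinders_measurable.
- exact: cylindersI.
- exact: cylindersT.
move=> B JB; rewrite setIC muleC.
exact: (indep_cylinders _ _ _ _ JJ' JA JB).
Qed.

Lemma measurable_sigmaJ (J : pred 'I_t) k : J k ->
  measurable_fun [set: sigmaJ J] (U k) /\ measurable_fun [set: sigmaJ J] (V k).
Proof.
move=> Jk; split => _ A mA; rewrite setTI; apply: sub_sigma_algebra.
  exists (fun i => if i == k then A else setT), (fun=> setT); split.
  - by move=> i; split => //; case: ifP.
  - by move=> i Ji; split => //; case: eqP => // ik; move: Ji; rewrite ik Jk.
  - apply/seteqP; split => w /=.
      by move=> h i _; split => //=; case: eqP => // ->.
    by move=> /(_ k I) [/=]; rewrite eqxx.
exists (fun=> setT), (fun i => if i == k then A else setT); split.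
- by move=> i; split => //; case: ifP.
- by move=> i Ji; split => //; case: eqP => // ik; move: Ji; rewrite ik Jk.
- apply/seteqP; split => w /=.
    by move=> h i _; split => //=; case: eqP => // ->.
  by move=> /(_ k I) [_ /=]; rewrite eqxx.
Qed.

Lemma measurable_sigmaJ_sqr (J : pred 'I_t) k : J k ->
  measurable_fun [set: sigmaJ J] (fun w => normc (hv k w) ^+ 2).
Proof.
move=> /measurable_sigmaJ [mU mV].
rewrite [X in measurable_fun _ X](_ : _ =
  fun w => complex.Re (hv k w) ^+ 2 + complex.Im (hv k w) ^+ 2); last first.
  by apply/funext => w; exact: sqr_normc.
by apply: measurable_funD; exact: measurable_funX.
Qed.

Definition hsq (k : 'I_t) (w : T) : R := normc (hv k w) ^+ 2.
Definition psum (i : nat) (w : T) : R := nrm2 (hv ^~ w) i.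

Lemma measurable_sigmaJ_psum i :
  measurable_fun [set: sigmaJ (fun k => (k < i)%N)] (psum i).
Proof.
rewrite [X in measurable_fun _ X](_ : _ =
  fun w => \sum_(k < t) if (k < i)%N then hsq k w else 0); last first.
  by apply/funext => w; rewrite /psum /nrm2 big_mkcond.
apply: measurable_sum => k.
by case: (boolP (k < i)%N) => ki //; exact: measurable_sigmaJ_sqr.
Qed.

Lemma measurable_hsq k : measurable_fun setT (hsq k).
Proof.
have [mU mV] := CN.1 k.
rewrite [X in measurable_fun _ X](_ : _ =
  fun w => complex.Re (hv k w) ^+ 2 + complex.Im (hv k w) ^+ 2); last first.
  by apply/funext => w; exact: sqr_normc.
by apply: measurable_funD; exact: measurable_funX.
Qed.

Lemma measurable_psum i : measurable_fun setT (psum i).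
Proof.
rewrite [X in measurable_fun _ X](_ : _ =
  fun w => \sum_(k < t) if (k < i)%N then hsq k w else 0); last first.
  by apply/funext => w; rewrite /psum /nrm2 big_mkcond.
apply: measurable_sum => k.
by case: (boolP (k < i)%N) => ki //; exact: measurable_hsq.
Qed.

(** [psum k] depends on the entries before k, [hsq k] on entry k alone. *)
Lemma indep_psum_hsq (k : 'I_t) A B : measurable A -> measurable B ->
  P (psum k @^-1` A `&` hsq k @^-1` B) = (P (psum k @^-1` A) * P (hsq k @^-1` B))%E.
Proof.
move=> mA mB.
apply: (@indep_sigmaJ (fun j => (j < k)%N) (pred1 k)).
- by move=> j jk /=; apply: contraTN jk => /eqP ->; rewrite ltnn.
- by have := @measurable_sigmaJ_psum k measurableT _ mA; rewrite setTI.
- have := @measurable_sigmaJ_sqr (pred1 k) k (eqxx k) measurableT _ mB.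
  by rewrite setTI.
Qed.

Lemma exp_law_hsq k : exp_law P (hsq k).
Proof.
move=> f mf f0; have [mU mV] := CN.1 k.
rewrite -(@ge0_integral_sqr_normal _ _ _ P _ _ f mU mV)//.
  by apply: eq_integral => w _; congr f; exact: sqr_normc.
move=> A B mA mB.
(* A cylinder constraining entry k only; all other factors of its probability are 1. *)
pose A' i := if i == k then A else setT.
pose B' i := if i == k then B else setT.
rewrite [X in P X](_ : _ = cylinder A' B'); last first.
  apply/seteqP; split => w.
    by move=> [wA wB] i _; rewrite /A' /B'; case: eqP => [->|].
  by move=> /(_ k I); rewrite /A' /B' eqxx.
rewrite CN.2; last by move=> i; rewrite /A' /B'; case: eqP.
rewrite (bigD1 k)//= big1 => [|i ik]; last first.
  by rewrite /A' /B' (negbTE ik) !probability_setT mulr1.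
by rewrite /A' /B' eqxx mulr1 EFinM !fineK ?fin_num_measure.
Qed.

End gaussian_vector.

(** * Renewal estimates *)

Section partial_sums.
Context {d} {T : measurableType d} {R : realType} (P : probability T R) (t : nat).
Variable hv : 'I_t -> T -> R[i].
Hypothesis CN : is_CN_std P hv.
Local Notation hsq := (hsq t hv).
Local Notation psum := (psum t hv).

Lemma hsq_ge0 k w : 0 <= hsq k w.
Proof. exact: sqr_ge0. Qed.

Lemma psum_ge0 i w : 0 <= psum i w.
Proof. by apply: sumr_ge0 => k _; exact: hsq_ge0. Qed.

Lemma psumS (k : 'I_t) w : psum k.+1 w = psum k w + hsq k w.
Proof.
rewrite /psum /nrm2 (bigD1 k)//= addrC; congr (_ + _).
apply: eq_bigl => i; rewrite ltnS andbC.
by rewrite [in RHS]ltn_neqAle.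
Qed.

Lemma measurable_psum_le i a : measurable [set w | psum i w <= a].
Proof.
have := measurable_psum P t hv CN i measurableT _ (measurable_itv `]-oo, a]).
rewrite setTI; congr measurable; apply/seteqP; split => w /=; by rewrite in_itv.
Qed.

Lemma measurable_xsection_law (S : T -> R) (D : set (R * R)) :
  measurable_fun setT S -> measurable D ->
  measurable_fun [set: R] (fun x => P [set w | D (x, S w)]).
Proof.
move=> mS mD.
pose S' : {mfun T >-> R} := mfun_Sub (mem_set mS : S \in mfun).
rewrite [X in measurable_fun _ X](_ : _ = fun x => distribution P S' (xsection D x)).
  exact: measurable_fun_xsection.
apply/funext => x; rewrite /distribution/pushforward; congr (P _).
by apply/seteqP; split => w /=; rewrite /xsection/= inE.
Qed.

Lemma measurable_add_le (a : R) : measurable [set z : R * R | z.2 + z.1 <= a].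
Proof.
have mf : measurable_fun setT (fun z : R * R => z.2 + z.1) by exact: measurable_funD.
have := mf measurableT _ (measurable_itv `]-oo, a]).
rewrite setTI; congr measurable; apply/seteqP; split => w /=; by rewrite in_itv.
Qed.

(** All [hsq] have the same law, so the last summand may be replaced by one fixed [hsq k0]. A sum
    over k then becomes a single integral. *)
Lemma psum_convolution (k k0 : 'I_t) (a : R) :
  P [set w | psum k.+1 w <= a] =
  (\int[P]_w P [set w' | (psum k w' + hsq k0 w <= a)%R])%E.
Proof.
have mS := measurable_psum P t hv CN k.
have mX := measurable_hsq P t hv CN k.
have XP := exp_law_hsq P t hv CN.
have mg := measurable_xsection_law _ _ mS (measurable_add_le a).
rewrite (XP k0 _ mg)// -(XP k _ mg)//.
rewrite -(indep_pair P _ _ _ mX mS _ (measurable_add_le a)).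
  by congr (P _); apply/seteqP; split => w /=; rewrite psumS.
move=> A B mA mB; rewrite setIC muleC; exact: indep_psum_hsq.
Qed.

(* The weights u + v j are carried along because conditioning on one exponential
   variable shifts j, i.e. replaces u by u + v. *)
Lemma sum_prob_psum_le (k0 : 'I_t) (u v : R) (n : nat) (a : R) : (n <= t)%N ->
  0 <= u -> 0 <= v -> 0 <= a ->
  (\sum_(j < n) (u + v * j.+1%:R)%:E * P [set w | (psum j.+1 w <= a)%R] <=
   (u * a + v * (a ^+ 2 / 2 + a))%:E)%E.
Proof.
move=> nt; elim: n nt u a => [_|n IH nt] u a u0 v0 a0.
  by rewrite big_ord0 lee_fin addr_ge0// mulr_ge0// addr_ge0// divr_ge0// sqr_ge0.
have mS j := measurable_psum P t hv CN j.
have mX := measurable_hsq P t hv CN k0.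
have XP := exp_law_hsq P t hv CN k0.
pose q (j : nat) (x : R) := P [set w' | psum j w' + x <= a].
have mq j : measurable_fun [set: R] (q j).
  exact: (measurable_xsection_law _ _ (mS j) (measurable_add_le a)).
have mqX j : measurable_fun setT (fun w => q j (hsq k0 w)).
  exact: (measurableT_comp (mq j)).
have c0 (j : nat) : 0 <= u + v * j.+1%:R by rewrite addr_ge0// mulr_ge0.
rewrite (eq_bigr (fun j : 'I_n.+1 => \int[P]_w ((u + v * j.+1%:R)%:E * q j (hsq k0 w)))%E); last first.
  move=> j _; rewrite ge0_integralZl//; last by rewrite lee_fin.
  by rewrite (psum_convolution (widen_ord nt j) k0).
rewrite -ge0_integral_sum//; last 2 first.
- by move=> j; exact: emeasurable_funM.
- by move=> j w _; rewrite mule_ge0// lee_fin.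
(* For g x = (u + v) x + (v / 2) x^2, the value g a is the claimed bound and g 0 = 0. *)
have := @exp_law_quad R _ _ P (hsq k0) a 0 (u + v) (v / 2) XP a0 (lexx _).
rewrite add0r mul0r subr0 => /(_ (addr_ge0 u0 v0) (divr_ge0 v0 (ler0n _ _))).
rewrite [X in _ = X%:E](_ : _ = u * a + v * (a ^+ 2 / 2 + a)); last by field.
move=> <-.
have mI : measurable_fun setT (fun w => (hsq k0 w <= a)%R%:R : R).
  rewrite (_ : (fun _ => _) = \1_(hsq k0 @^-1` `]-oo, a]%classic)).
    by apply: measurable_indic; rewrite -[X in measurable X]setTI; exact: mX.
  apply/funext => w; rewrite indicE; congr ((nat_of_bool _)%:R).
  by apply/idP/idP; rewrite inE/= in_itv/=.
apply: ge0_le_integral => //.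
- by move=> w _; apply: sume_ge0 => j _; rewrite mule_ge0// lee_fin.
- by apply: emeasurable_sum => j; exact: emeasurable_funM.
- apply/measurable_EFinP; apply: measurable_funM => //.
  have mB : measurable_fun setT (fun w => a - hsq k0 w) by exact: measurable_funB.
  by apply: measurable_funD; [apply: measurable_funD => //|];
    apply: measurable_funM => //; exact: measurable_funX.
move=> w _; have [Xa|aX] := leP (hsq k0 w) a; last first.
  rewrite mul0r big1// => j _; rewrite /q (_ : [set w' | _] = set0) ?measure0 ?mule0//.
  apply/seteqP; split => // w' /=; rewrite leNgt => /negP; apply.
  by rewrite (lt_le_trans aX)// lerDr psum_ge0.
have b0 : 0 <= a - hsq k0 w by rewrite subr_ge0.
rewrite big_ord_recl mul1r.
(* In (g + g')(a - X), the part u + v pays for the first term of the sum; the rest is the induction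
   bound at level a - X with u replaced by u + v. *)
have -> : (u + v + (u + v + 2 * (v / 2)) * (a - hsq k0 w) + v / 2 * (a - hsq k0 w) ^+ 2) =
  (u + v) + ((u + v) * (a - hsq k0 w) + v * ((a - hsq k0 w) ^+ 2 / 2 + (a - hsq k0 w))).
  by field.
rewrite [leRHS]EFinD; apply: leeD.
  rewrite mulr1 -[leRHS]mule1; apply: lee_wpmul2l; first by rewrite lee_fin addr_ge0.
  rewrite /q (_ : [set w' | _] = [set w' | psum 0 w' <= a - hsq k0 w]).
    by apply: probability_le1; exact: measurable_psum_le.
  by apply/seteqP; split => w' /=; rewrite lerBrDr.
apply: le_trans (IH (ltnW nt) (u + v) _ (addr_ge0 u0 v0) v0 b0).
rewrite le_eqVlt; apply/orP; left; apply/eqP; apply: eq_bigr => j _.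
rewrite /bump/= /q; congr (_%:E * P _)%E.
  by rewrite /bump leq0n add1n -[in LHS]natr1; ring.
by apply/seteqP; split => w' /=; rewrite lerBrDr.
Qed.

End partial_sums.

Section integral_mono.
Context {d} {T : measurableType d} {R : realType} (mu : {measure set T -> \bar R}).

(* [ge0_le_integral] asks for measurability of both functions; this version
   spares proving that the feedback length is measurable. *)
Lemma ge0_le_integral_nonmeasurable (f g : T -> \bar R) :
  (forall x, 0 <= f x)%E -> (forall x, f x <= g x)%E ->
  (\int[mu]_x f x <= \int[mu]_x g x)%E.
Proof.
move=> f0 fg.
have g0 x : (0 <= g x)%E by exact: le_trans (f0 x) (fg x).
rewrite !ge0_integralTE//.
apply: le_ereal_sup => _ [h hf <-]; exists h => // x.
exact: le_trans (hf x) (fg x).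
Qed.

End integral_mono.

(** * Absence of atoms, and the probability of a small overshoot *)

Section overshoot.
Context {d} {T : measurableType d} {R : realType} (P : probability T R) (t : nat).
Variable hv : 'I_t -> T -> R[i].
Hypothesis CN : is_CN_std P hv.
Local Notation hsq := (hsq t hv).
Local Notation psum := (psum t hv).

(** The point lies in an interval of length e, of probability at most e, for every e > 0. *)
Lemma hsq_atomless (k : 'I_t) (b : R) : P [set w | hsq k w = b] = 0%E.
Proof.
have mX := measurable_hsq P t hv CN k.
have mb : measurable [set w | hsq k w = b].
  by rewrite -[X in measurable X]setTI; exact: (mX measurableT [set b]).
apply/eqP; rewrite eq_le measure_ge0 andbT; apply/lee_addgt0Pr => e e0; rewrite add0e.
rewrite [leRHS](_ : _ = (b - (b - e))%:E); last by congr EFin; ring.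
apply: le_trans (exp_law_itv P (hsq k) (b - e) b mX (hsq_ge0 t hv k) (exp_law_hsq P t hv CN k) _).
  apply: le_measure; rewrite ?inE//.
    by rewrite -[X in measurable X]setTI; exact: mX.
  by move=> w /= ->; rewrite in_itv/= lexx andbT ltrBlDr ltrDl.
by rewrite lerBlDr lerDl ltW.
Qed.

Lemma psum_atomless (k : 'I_t) (a : R) : P [set w | psum k.+1 w = a] = 0%E.
Proof.
have mS := measurable_psum P _ hv CN k.
have mX := measurable_hsq P _ hv CN k.
have mD : measurable [set z : R * R | z.1 + z.2 = a].
  have mf : measurable_fun setT (fun z : R * R => z.1 + z.2) by exact: measurable_funD.
  by have := mf measurableT [set a] (measurable_set1 _); rewrite setTI.
rewrite (_ : [set w | _] = [set w | [set z | z.1 + z.2 = a] (psum k w, hsq k w)]); last first.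
  by apply/seteqP; split => w /=; rewrite psumS.
rewrite (indep_pair P _ _ [set z | z.1 + z.2 = a] mS mX _ mD).
  rewrite integral0_eq// => w _ /=.
  rewrite (_ : [set w' | _] = [set w' | hsq k w' = a - psum k w]).
    exact: hsq_atomless.
  by apply/seteqP; split => w' /=; [move=> <-; ring|move=> ->; ring].
by move=> A B mA mB; exact: indep_psum_hsq.
Qed.

(** Given [psum k], the next summand must fall into an interval of length e. *)
Lemma overshoot_le (k : 'I_t) (a e : R) : 0 <= e ->
  (P [set w | [/\ (psum k w <= a)%R, (a < psum k.+1 w)%R & (psum k.+1 w <= a + e)%R]] <=
   e%:E * P [set w | (psum k w <= a)%R])%E.
Proof.
move=> e0.
have mS := measurable_psum P t hv CN k.
have mX := measurable_hsq P t hv CN k.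
pose D : set (R * R) := [set z | z.1 <= a] `&`
  ((fun z => z.1 + z.2) @^-1` `]a, a + e]%classic).
have mD : measurable D.
  apply: measurableI.
    have := @measurable_fst _ _ R R measurableT _ (measurable_itv `]-oo, a]).
    by rewrite setTI; congr measurable; apply/seteqP; split => w /=; rewrite in_itv.
  rewrite -[X in measurable X]setTI.
  have mf : measurable_fun setT (fun z : R * R => z.1 + z.2) by exact: measurable_funD.
  exact: mf.
rewrite (_ : [set w | _] = [set w | D (psum k w, hsq k w)]); last first.
  apply/seteqP; split => w /=; rewrite psumS /D/= in_itv/=.
    by move=> [? -> ->].
  by move=> [? /andP[]].
rewrite (indep_pair P _ _ D mS mX _ mD); last first.
  by move=> A B mA mB; exact: indep_psum_hsq.
rewrite -[X in (_ <= _ * P X)%E]setIT -integral_indic//; last exact: (measurable_psum_le P t hv CN).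
rewrite -ge0_integralZl//; last first.
  by apply/measurable_EFinP; apply: measurable_indic; exact: (measurable_psum_le P t hv CN).
apply: ge0_le_integral_nonmeasurable => // w.
have [Sa|aS] := leP (psum k w) a; last first.
  rewrite (_ : [set w' | _] = set0) ?measure0 ?mule_ge0//.
  by apply/seteqP; split => // w' [/=]; rewrite leNgt aS.
rewrite indicE mem_set//= mule1.
rewrite (_ : [set w' | _] = hsq k @^-1` `]a - psum k w, a - psum k w + e]%classic).
  rewrite [leRHS](_ : _ = ((a - psum k w + e) - (a - psum k w))%:E); last first.
    by congr EFin; ring.
  apply: exp_law_itv => //; [exact: hsq_ge0|exact: exp_law_hsq|].
  by rewrite lerDl.
apply/seteqP; split => w' /=; rewrite /D/= !in_itv/=.
  by move=> [_ /andP[h1 h2]]; apply/andP; split; lra.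
by move=> /andP[h1 h2]; split => //; apply/andP; split; lra.
Qed.

End overshoot.

(** * Expected costs and outage *)

Section expectations.
Context {d} {T : measurableType d} {R : realType} (P : probability T R) (t : nat).
Variables (alpha : R) (hv : 'I_t -> T -> R[i]).
Hypotheses (t0 : (0 < t)%N) (alpha0 : 0 < alpha) (CN : is_CN_std P hv).
Local Notation psum := (psum t hv).
Local Notation hsq := (hsq t hv).
Local Notation h := (fun w k => hv k w).

Let stays (i : nat) : set T := [set w | psum i w <= alpha].
Let overshoots (k m : nat) : set T :=
  [set w | [/\ psum k w <= alpha, alpha < psum k.+1 w &
               psum k.+1 w <= alpha + alpha / 2 ^+ m]].

(** Majorant of the [N] of [feedbackD_le] for a stop at [k.+1]; being a series of indicators, its
    expectation is a series of probabilities. *)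
Let count (k : nat) (w : T) : \bar R := (\sum_(m <oo) (\1_(overshoots k m) w)%:E)%E.

Lemma count_ge0 k w : (0 <= count k w)%E.
Proof. by apply: nneseries_ge0 => m _ _; rewrite lee_fin. Qed.

Lemma measurable_stays i : measurable (stays i).
Proof. exact: (measurable_psum_le P t hv CN). Qed.

Lemma measurable_overshoots k m : measurable (overshoots k m).
Proof.
have m1 := measurable_stays k; have m2 := measurable_stays k.+1.
have m3 := measurable_psum_le P t hv CN k.+1 (alpha + alpha / 2 ^+ m).
rewrite (_ : overshoots k m = (stays k `\` stays k.+1) `&`
  [set w | psum k.+1 w <= alpha + alpha / 2 ^+ m]).
  by apply: measurableI => //; exact: measurableD.
apply/seteqP; split => w /=; rewrite /stays /overshoots/=.
  by move=> [h1 h2 h3]; split => //; split => //; apply/negP; rewrite -ltNge.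
by move=> [[h1 /negP h2] h3]; split => //; rewrite ltNge.
Qed.

Lemma integral_affine_stays (n : nat) (c : R) (u : nat -> R) :
  0 <= c -> (forall j, 0 <= u j) ->
  (\int[P]_w (c + \sum_(j < n) u j * (psum j.+1 w <= alpha)%R%:R)%:E =
   c%:E + \sum_(j < n) (u j)%:E * P (stays j.+1))%E.
Proof.
move=> c0 u0.
have mst (j : nat) : measurable_fun setT (fun w => (\1_(stays j.+1) w)%:E : \bar R).
  by apply/measurable_EFinP; apply: measurable_indic; exact: measurable_stays.
transitivity (\int[P]_w (c%:E + \sum_(j < n) (u j)%:E * (\1_(stays j.+1) w)%:E))%E.
  apply: eq_integral => w _; rewrite EFinD -sumEFin; congr (_ + _)%E.
  apply: eq_bigr => j _; rewrite EFinM; congr (_ * _%:E)%E.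
  rewrite indicE; congr ((nat_of_bool _)%:R).
  by apply/idP/idP; rewrite inE.
rewrite ge0_integralD//; last 2 first.
- by move=> w _; apply: sume_ge0 => j _; rewrite mule_ge0// lee_fin.
- by apply: emeasurable_sum => j; exact: emeasurable_funM.
have -> : (\int[P]_w c%:E = c%:E)%E by rewrite integral_cst// [X in (_ * X)%E]probability_setT mule1.
congr (_ + _)%E.
rewrite ge0_integral_sum//; last 2 first.
- by move=> j; exact: emeasurable_funM.
- by move=> j w _; rewrite mule_ge0// lee_fin.
apply: eq_bigr => j _; rewrite ge0_integralZl//; last by rewrite lee_fin.
by rewrite integral_indic ?setIT//; exact: measurable_stays.
Qed.

(** The bounds alpha / 2^m from [overshoot_le] form a geometric series of sum 2 alpha. *)
Lemma series_overshoots (k : 'I_t) :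
  (\sum_(m <oo) P (overshoots k m) <= (2 * alpha)%:E * P (stays k))%E.
Proof.
apply: lime_le; first by apply: is_cvg_nneseries => n _ _; exact: measure_ge0.
apply: nearW => n.
apply: (@le_trans _ _ (\sum_(0 <= m < n) (alpha / 2 ^+ m)%:E * P (stays k))%E).
  apply: lee_sum => m _; apply: overshoot_le => //.
  by rewrite divr_ge0// ?exprn_ge0// ltW.
rewrite -ge0_sume_distrl; last first.
  by move=> m _; rewrite lee_fin divr_ge0// ?exprn_ge0// ltW.
apply: lee_wpmul2r; first exact: measure_ge0.
rewrite sumEFin lee_fin.
have -> : \sum_(0 <= m < n) alpha / 2 ^+ m = 2 * alpha - 2 * alpha / 2 ^+ n.
  elim: n => [|n IH]; first by rewrite big_nil expr0 divr1 subrr.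
  rewrite big_nat_recr//= IH exprS; field.
  by rewrite expf_neq0.
by rewrite gerBl divr_ge0// ?exprn_ge0// mulr_ge0// ltW.
Qed.

Lemma sum_stays_le (u v : R) : 0 <= u -> 0 <= v ->
  (\sum_(j < t.-1) (u + v * j.+1%:R)%:E * P (stays j.+1) <=
   (u * alpha + v * (alpha ^+ 2 / 2 + alpha))%:E)%E.
Proof.
move=> u0 v0; apply: (sum_prob_psum_le P t hv CN (Ordinal t0)) => //; last exact: ltW.
exact: leq_pred.
Qed.

Lemma expected_training :
  (\int[P]_w ((trainedD alpha (h w))%:R)%:E <= (1 + alpha)%:E)%E.
Proof.
rewrite (eq_integral (fun w => (1 + \sum_(j < t.-1) 1 * (psum j.+1 w <= alpha)%R%:R)%:E)).
  rewrite (integral_affine_stays _ _ (fun=> 1))// EFinD; apply: leeD => //.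
  have := sum_stays_le 1 0 ler01 (lexx _).
  rewrite mul1r mul0r addr0; apply: le_trans.
  by apply: lee_sum => j _; rewrite mul0r addr0.
move=> w _; congr EFin.
rewrite /trainedD (stopD_telescope _ _ _ t0 (fun n => n%:R)); congr (_ + _).
by apply: eq_bigr => j _; congr (_ * _); rewrite -[j.+2%:R]natr1; ring.
Qed.

(** With c i = 2 i^2 + 9 i - 1, the constant 10 is c 1, and 11 + 4 (j + 1) is the increment c (j +
    2) - c (j + 1). *)
Let bound (w : T) : \bar R :=
  ((10 + \sum_(j < t.-1) (11 + 4 * j.+1%:R) * (psum j.+1 w <= alpha)%R%:R)%:E +
   \sum_(k < t) (2 * k.+1%:R)%:E * count k w)%E.

Lemma feedback_le_bound w : (0 <= (feedbackD alpha (h w))%:E <= bound w)%E.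
Proof.
have [N [hN /andP[f0 fN]]] := feedbackD_le _ _ (h w) t0 alpha0.
rewrite lee_fin f0/=; move: fN.
set f := firstD alpha (h w).
rewrite (stopD_telescope _ _ _ t0 (fun i : nat => 2 * i%:R ^+ 2 + 9 * i%:R - 1)) => fN.
have S0 (k : 'I_t) : (0 <= (2 * k.+1%:R)%:E * count k w)%E.
  apply: mule_ge0; first by rewrite lee_fin mulr_ge0.
  exact: count_ge0.
rewrite -lee_fin in fN; apply: (le_trans fN); rewrite EFinD; apply: leeD.
  rewrite lee_fin lerD//.
    by rewrite expr1n; lra.
  apply: ler_sum => j _; rewrite ler_wpM2r// -[j.+2%:R]natr1; nra.
have [->|N0] := posnP N; first by rewrite mulr0; exact: sume_ge0.
have [ex _] := hN _ N0.
have /andP[c1 c2] := exceedD_crossing _ _ _ alpha0 ex.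
(* Only the crossing index k = f is needed to dominate [N]; the other terms are dropped as
   nonnegative. *)
rewrite (bigD1 (Ordinal ex))//= -[leLHS]adde0.
apply: leeD; last exact: sume_ge0.
rewrite EFinM; apply: lee_wpmul2l; first by rewrite lee_fin mulr_ge0.
apply: (@le_trans _ _ (\sum_(0 <= m < N) (\1_(overshoots f m) w)%:E)%E); last first.
  by apply: nneseries_lim_ge => m _; rewrite lee_fin.
rewrite big_mkord sumEFin lee_fin.
rewrite (eq_bigr (fun=> 1)); first by rewrite sumr_const card_ord.
move=> m _; rewrite indicE mem_set//.
by have [_ ?] := hN m (ltn_ord m); split.
Qed.

Lemma expected_feedback :
  (\int[P]_w (feedbackD alpha (h w))%:E <= (92 * (1 + alpha ^+ 3))%:E)%E.
Proof.
apply: (@le_trans _ _ (\int[P]_w bound w)%E).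
  by apply: ge0_le_integral_nonmeasurable => w; have /andP[] := feedback_le_bound w.
have mI k m : measurable_fun setT (fun w => (\1_(overshoots k m) w)%:E : \bar R).
  by apply/measurable_EFinP; apply: measurable_indic; exact: measurable_overshoots.
have mS k : measurable_fun setT (count k).
  by apply: ge0_emeasurable_sum => // m w _ _; rewrite lee_fin.
have S0 k w : (0 <= count k w)%E by exact: count_ge0.
have mst (j : nat) : measurable_fun setT (fun w => (psum j.+1 w <= alpha)%R%:R : R).
  rewrite (_ : (fun _ => _) = \1_(stays j.+1)).
    by apply: measurable_indic; exact: measurable_stays.
  apply/funext => w; rewrite indicE; congr ((nat_of_bool _)%:R).
  by apply/idP/idP; rewrite inE.
rewrite ge0_integralD//; last 3 first.
- apply/measurable_EFinP; apply: measurable_funD => //.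
  by apply: measurable_sum => j; exact: measurable_funM.
- by move=> w _; apply: sume_ge0 => k _; rewrite mule_ge0// lee_fin mulr_ge0.
- by apply: emeasurable_sum => k; exact: emeasurable_funM.
rewrite (integral_affine_stays _ _ (fun j => 11 + 4 * j.+1%:R))//.
rewrite ge0_integral_sum//; last 2 first.
- by move=> k; exact: emeasurable_funM.
- by move=> k w _; rewrite mule_ge0// lee_fin mulr_ge0.
have h1 := sum_stays_le 11 4 (ler0n _ _) (ler0n _ _).
(* The weight 1 + (j + 1) is the k + 1 of [h4] after the shift k = j + 1. *)
have h2 := sum_stays_le 1 1 ler01 ler01.
have h3 : (\sum_(k < t) \int[P]_w ((2 * k.+1%:R)%:E * count k w) <=
   (4 * alpha)%:E * \sum_(k < t) (k.+1%:R)%:E * P (stays k))%E.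
  rewrite ge0_sume_distrr; last by move=> k _; rewrite mule_ge0// lee_fin.
  apply: lee_sum => k _.
  rewrite ge0_integralZl//.
  rewrite integral_nneseries//.
  rewrite (eq_eseriesr (g := fun m => P (overshoots k m))); last first.
    by move=> m _; rewrite integral_indic ?setIT//; exact: measurable_overshoots.
  apply: (@le_trans _ _ ((2 * k.+1%:R)%:E * ((2 * alpha)%:E * P (stays k)))%E).
    by apply: lee_wpmul2l; [rewrite lee_fin mulr_ge0|exact: series_overshoots].
  rewrite !muleA -!EFinM le_eqVlt; apply/orP; left; apply/eqP; congr (_%:E * _)%E; ring.
(* The term k = 0 falls outside the renewal sum and is bounded by 1. *)
have h4 : (\sum_(k < t) (k.+1%:R)%:E * P (stays k) <=
    (1 + (1 * alpha + 1 * (alpha ^+ 2 / 2 + alpha)))%:E)%E.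
  have recl (F : nat -> \bar R) : (\sum_(k < t) F k = F 0%N + \sum_(j < t.-1) F j.+1)%E.
    by case: t t0 => // n _; rewrite big_ord_recl.
  rewrite (recl (fun k => (k.+1%:R)%:E * P (stays k))%E) [leRHS]EFinD; apply: leeD.
    by rewrite mul1e probability_le1//; exact: measurable_stays.
  apply: le_trans h2; apply: lee_sum => j _.
  by rewrite mul1r -[j.+2%:R]natr1 addrC.
apply: le_trans (leeD (leeD (lexx _) h1) (le_trans h3 (lee_wpmul2l _ h4))) _.
  by rewrite lee_fin mulr_ge0// ltW.
rewrite -EFinM -!EFinD lee_fin.
(* [a1] and [a2] expand to 3 alpha <= alpha^3 + 2 and 3 alpha^2 <= 2 alpha^3 + 1, so 10 + 19 alpha +
   10 alpha^2 + 2 alpha^3 is at most 26 + 15 alpha^3. *)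
have a1 : 0 <= (alpha - 1) ^+ 2 * (alpha + 2).
  by rewrite mulr_ge0 ?sqr_ge0// addr_ge0// ltW.
have a2 : 0 <= (alpha - 1) ^+ 2 * (2 * alpha + 1).
  by rewrite mulr_ge0 ?sqr_ge0// addr_ge0// mulr_ge0// ltW.
nra.
by move=> w _; rewrite lee_fin addr_ge0// sumr_ge0.
Qed.

Lemma outage_beamF : outage P alpha hv (@beamF R t) = P [set w | psum t w < alpha].
Proof. by congr (P _); apply/seteqP; split => w /=; rewrite gain_beamF. Qed.

Lemma gain_beamD_nexceed w : ~~ exceedD alpha (h w) ->
  gain (beamD alpha (h w)) (h w) = hsq (Ordinal t0) w.
Proof.
move=> nex; rewrite /gain (bigD1 (Ordinal t0))//= big1 => [|k k0].
  by rewrite /beamD (negbTE nex) /= rmorph1 mul1r addr0.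
rewrite /beamD (negbTE nex) (_ : (val k == 0%N) = false) ?rmorph0 ?mul0r//.
by apply: contraNF k0 => /eqP k0; apply/eqP/val_inj.
Qed.

Lemma outage_beamD : outage P alpha hv (@beamD R t alpha) = P [set w | psum t w < alpha].
Proof.
pose k1 := Ordinal t0.
have hk w : hsq k1 w <= psum t w.
  apply: (@le_trans _ _ (psum 1 w)); last exact: nrm2_nd.
  by rewrite (psumS _ hv k1) lerDr psum_ge0.
(* Exact outage event of D: no exceedance, and too small a gain along [e_1]. It lies between {S_t <
   alpha} and {S_t <= alpha}. *)
have -> : outage P alpha hv (@beamD R t alpha) =
    P [set w | psum t w <= alpha /\ hsq k1 w < alpha].
  congr (P _); apply/seteqP; split => w /=.
    have [ex|nex] := boolP (exceedD alpha (h w)).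
      rewrite ltNge gain_beamD_exceed// /stopD ex.
      by have /andP[] := exceedD_crossing _ _ _ alpha0 ex.
    by rewrite gain_beamD_nexceed// => hka; split => //; exact: nexceedD_le.
  move=> [ta ka]; rewrite gain_beamD_nexceed//; apply/negP => ex.
  have /andP[_] := exceedD_crossing _ _ _ alpha0 ex.
  by rewrite ltNge (le_trans _ ta)//; exact: nrm2_nd.
have mX := measurable_hsq P t hv CN k1.
have mS := measurable_psum P t hv CN t.
have m1 : measurable [set w | psum t w < alpha].
  rewrite (_ : [set w | _] = psum t @^-1` `]-oo, alpha[%classic).
    by rewrite -[X in measurable X]setTI; exact: mS.
  by apply/seteqP; split => w /=; rewrite in_itv.
have m2 : measurable [set w | psum t w = alpha].
  by rewrite -[X in measurable X]setTI; exact: (mS measurableT [set alpha]).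
have m3 : measurable [set w | psum t w <= alpha /\ hsq k1 w < alpha].
  rewrite (_ : [set w | _] = psum t @^-1` `]-oo, alpha]%classic `&`
      hsq k1 @^-1` `]-oo, alpha[%classic).
    by apply: measurableI; rewrite -[X in measurable X]setTI; [exact: mS|exact: mX].
  by apply/seteqP; split => w /=; rewrite !in_itv.
have null : P [set w | psum t w = alpha] = 0%E.
  have tl : (t.-1 < t)%N by rewrite prednK.
  by have := psum_atomless P t hv CN (Ordinal tl) alpha; rewrite /= prednK.
apply/eqP; rewrite eq_le; apply/andP; split; last first.
  apply: le_measure; rewrite ?inE// => w /= ta; split; first exact: ltW.
  exact: le_lt_trans (hk w) ta.
rewrite -[leRHS](measureU0 m1 m2 null).
apply: le_measure; rewrite ?inE//; first exact: measurableU.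
by move=> w /= [ta _]; case: ltgtP ta => //; [left|right].
Qed.

End expectations.

Theorem theorem2 (d : measure_display) (T : measurableType d) (R : realType)
  (P : probability T R) (t : nat) (alpha : R) (hv : 'I_t -> T -> R[i]) :
  (0 < t)%N -> 0 < alpha -> is_CN_std P hv ->
  let h := fun w => (fun k => hv k w) in
  outage P alpha hv (@beamD R t alpha) = outage P alpha hv (@beamF R t) /\
  outage P alpha hv (@beamF R t) = P [set w | nrm2 (h w) t < alpha] /\
  (\int[P]_w ((trainedD alpha (h w))%:R)%:E <= (1 + alpha)%:E)%E /\
  (\int[P]_w (feedbackD alpha (h w))%:E <= (92 * (1 + alpha ^+ 3))%:E)%E.
Proof.
move=> t0 alpha0 CN h.
rewrite (outage_beamD P t alpha hv t0 alpha0 CN) outage_beamF; do 3?split => //.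
  exact: expected_training.
exact: expected_feedback.
Qed.
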